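(* Let $\mathcal{A}$ be a set of attributes, viewed as propositional atoms. For any stratified knowledge base $\Theta$ over $\mathcal{A}$, there exist embeddings $\mathbf{a}\in\mathbb{R}^m$ of the attributes $a\in\mathcal{A}$ (for some dimension $m$) such that for all $b\in\mathcal{A}$ and $\{a_1,\dots,a_n\}\subseteq\mathcal{A}$: $$b\in \mathrm{Lab}_{\mathrm{relu}}(\mathrm{Emb}_{\mathrm{avg}}(a_1,\dots,a_n)) \iff \Theta\models a_1\wedge\dots\wedge a_n\vartriangleright b .$$
   Context: A stratified knowledge base over $\mathcal{A}$ is a ranked list $\Theta=(\alpha_1,\dots,\alpha_k)$ of propositional formulas over the atoms in $\mathcal{A}$. For propositional formulas $\alpha,\beta$, one writes $\Theta\models\alpha\vartriangleright\beta$ iff there is some $i\in\{0,\dots,k\}$ such that $\alpha_1\wedge\dots\wedge\alpha_i\wedge\alpha\models\beta$ and $\alpha_1\wedge\dots\wedge\alpha_i\wedge\alpha\not\models\neg\beta$, where in these two conditions $\models$ is standard propositional entailment (for $i=0$ the premise is just $\alpha$). Each attribute $a\in\mathcal{A}$ is represented by a single vector $\mathbf{a}\in\mathbb{R}^m$, where the number of dimensions $m$ may be chosen arbitrarily large; this same vector is used in both of the following functions. The embedding function $\mathrm{Emb}_{\mathrm{avg}}:2^{\mathcal{A}}\rightarrow\mathbb{R}^m$ is given by $\mathrm{Emb}_{\mathrm{avg}}(a_1,\dots,a_n)=\frac{1}{n}(\mathbf{a}_1+\dots+\mathbf{a}_n)$, where $\mathbf{a}_i$ is the vector of $a_i$.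 The labelling function $\mathrm{Lab}_{\mathrm{relu}}:\mathbb{R}^m\rightarrow 2^{\mathcal{A}}$ is given by $\mathrm{Lab}_{\mathrm{relu}}(\mathbf{e})=\{b\in\mathcal{A}\mid \mathrm{ReLU}(\mathbf{e})\cdot\mathbf{b}\geq 0\}$, where $\mathrm{ReLU}(t)=\max(t,0)$ is applied component-wise.
   Formalization: The attribute set A is taken to be finite (for infinite A no fixed dimension m can work, already for the empty knowledge base), and {a_1,…,a_n} is taken to be non-empty (for n = 0 the average with factor 1/n is undefined). *)

(* Defs.v *)
From mathcomp Require Import all_boot all_order all_algebra.
From mathcomp Require Import reals.

Set Implicit Arguments.
Unset Strict Implicit.
Unset Printing Implicit Defensive.

Import Order.TTheory GRing.Theory Num.Theory.
Local Open Scope ring_scope.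

Inductive form (A : Type) : Type :=
| FVar of A
| FTrue
| FFalse
| FNot of form A
| FAnd of form A & form A
| FOr of form A & form A
| FImp of form A & form A.

Arguments FTrue {A}.
Arguments FFalse {A}.

Fixpoint eval (A : Type) (v : A -> bool) (f : form A) : bool :=
  match f with
  | FVar a => v a
  | FTrue => true
  | FFalse => false
  | FNot g => ~~ eval v g
  | FAnd g h => eval v g && eval v h
  | FOr g h => eval v g || eval v h
  | FImp g h => eval v g ==> eval v h
  end.

Definition entails (A : Type) (f g : form A) : Prop :=
  forall v : A -> bool, eval v f -> eval v g.

(* The head of the list is the first (most certain) stratum. *)
Definition stratified_kb (A : Type) : Type := seq (form A).

(* [premise Theta i f] is alpha_1 /\ ... /\ alpha_i /\ f, which is [f] itself *)
(* for i = 0.                                                                 *)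
Definition premise (A : Type) (Theta : stratified_kb A) (i : nat) (f : form A) :
    form A :=
  foldr (@FAnd A) f (take i Theta).

(* Theta |= f |> g *)
Definition kb_entails (A : Type) (Theta : stratified_kb A) (f g : form A) :
    Prop :=
  exists i : nat,
    [/\ (i <= size Theta)%N,
        entails (premise Theta i f) g
      & ~ entails (premise Theta i f) (FNot g)].

(* a_1 /\ ... /\ a_n for X = {a_1, ..., a_n}, with a final neutral conjunct *)
(* [FTrue].                                                                 *)
Definition conj_atoms (A : finType) (X : {set A}) : form A :=
  foldr (@FAnd A) FTrue [seq FVar a | a <- enum X].

Definition dotrv (R : realType) (m : nat) (u v : 'rV[R]_m) : R :=
  \sum_(j < m) u 0 j * v 0 j.

Definition relu (R : realType) (m : nat) (u : 'rV[R]_m) : 'rV[R]_m :=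
  map_mx (fun t : R => Num.max t 0) u.

(* The average is only meaningful for nonempty X; on [set0] the library's *)
(* convention 0^-1 = 0 yields the zero vector.                            *)
Definition Emb_avg (R : realType) (A : finType) (m : nat)
    (emb : A -> 'rV[R]_m) (X : {set A}) : 'rV[R]_m :=
  #|X|%:R^-1 *: \sum_(a in X) emb a.

Definition Lab_relu (R : realType) (A : finType) (m : nat)
    (emb : A -> 'rV[R]_m) (e : 'rV[R]_m) : {set A} :=
  [set b | 0 <= dotrv (relu e) (emb b)].

(* Main.v *)
Require Import Defs.
From mathcomp Require Import all_boot all_order all_algebra.
From mathcomp Require Import reals.

(** A world is a set [W] of attributes, ranked by the number of leading strata
    that it satisfies: [Theta |= X |> b] holds iff [b] belongs to every world of
    maximal rank among those containing [X].  Give each world [W] its own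
    coordinate, in which [a] has value [N ^ rank W] if [a] is in [W] and
    [- N * N ^ rank W] otherwise, where [N] is the number of worlds.  As
    [N > #|A|], one attribute of [X] outside [W] already makes the average
    negative, so after ReLU only the worlds containing [X] remain active, and
    the score of [b] is the sum of [+- N ^ (2 * rank W)] over them, with an extra
    factor [N] on the negative terms.  That factor lets a single world of maximal
    rank veto [b]; the geometric growth in the rank lets a world of maximal rank
    outweigh all worlds of lower rank. *)

Set Implicit Arguments.
Unset Strict Implicit.
Unset Printing Implicit Defensive.

Import Order.TTheory GRing.Theory Num.Theory.
Local Open Scope ring_scope.

Definition vote (R : realType) (T : finType) (g : pred T) (x : T) : R :=
  if g x then 1 else - #|T|%:R.

Lemma vote_sum_ge0 (R : realType) (T : finType) (P g : pred T) (r : T -> nat)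
    (x0 : T) :
  P x0 ->
  0 <= \sum_(x | P x) (#|T|%:R ^+ r x) ^+ 2 * vote R g x
  <-> (forall x, P x -> (forall y, P y -> (r y <= r x)%N) -> g x).
Proof.
move=> Px0; set N : R := #|T|%:R.
have N1 : 1 <= N by rewrite ler1n; apply/card_gt0P; exists x0.
have N0 : 0 < N := lt_le_trans ltr01 N1.
have mono i j : (i <= j)%N -> (N ^+ i) ^+ 2 <= (N ^+ j) ^+ 2.
  by move=> ij; rewrite -!exprM ler_weXn2l // leq_mul2r.
have pos i : 0 < (N ^+ i) ^+ 2 by rewrite !exprn_gt0.
have others x (c : R) : 0 < c -> \sum_(y | P y && (y != x)) c < N * c.
  move=> c0; rewrite sumr_const -mulr_natl ltr_pM2r // ltr_nat.
  apply: proper_card; apply/properP; split; first exact/subsetP.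
  by exists x; rewrite // unfold_in eqxx andbF.
split=> [+ x Px topx|top].
  (* A maximal [x] failing [g] contributes -N * N^(2 r x), while each of the fewer than [N] other
     terms is at most N^(2 r x). *)
  apply: contraTT => gx; rewrite -ltNge (bigD1 x) //= {1}/vote (negPf gx).
  rewrite mulrN addrC subr_lt0 [ltRHS]mulrC.
  apply: le_lt_trans (others x _ (pos (r x))).
  apply: ler_sum => y /andP[Py _].
  apply: le_trans (mono _ _ (topx y Py)).
  rewrite ler_piMr ?(ltW (pos _)) // /vote; case: (g y) => //.
  by rewrite (le_trans _ ler01) // oppr_le0 ltW.
have [x Px topx] : exists2 x, P x & forall y, P y -> (r y <= r x)%N.
  by case: (arg_maxnP r Px0) => x Px topx; exists x.
(* Multiply by [N]: a [y] failing [g] has smaller rank than [x], so [N] times its loss is N^(2 (r y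
   + 1)) <= N^(2 r x), and fewer than [N] such [y] exist. *)
rewrite -(pmulr_rge0 _ N0) (bigD1 x) //= {1}/vote (top x Px topx) mulr1 mulrDr.
rewrite -[X in _ + X]opprK subr_ge0 mulr_sumr -sumrN.
apply: le_trans (ltW (others x _ (pos (r x)))).
apply: ler_sum => y /andP[Py _]; rewrite /vote -/N.
case: ifPn => [_|gy].
  by rewrite mulr1 (le_trans _ (ltW (pos _))) // oppr_le0 mulr_ge0 ?(ltW N0) ?(ltW (pos _)).
have ryx : (r y < r x)%N.
  rewrite ltn_neqAle topx // andbT; apply: contra gy => /eqP e.
  by apply: top => // z Pz; rewrite e; apply: topx.
rewrite !mulrN opprK mulrCA -expr2 -exprMn -exprSr.
exact: mono.
Qed.

Definition rank (A : finType) (Theta : stratified_kb A) (W : {set A}) : nat :=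
  find (fun f => ~~ eval (mem W) f) Theta.

Lemma eval_ext (A : Type) (v w : A -> bool) (f : Defs.form A) :
  v =1 w -> eval v f = eval w f.
Proof.
by move=> vw; elim: f => //= [g ->|g -> h ->|g -> h ->|g -> h ->].
Qed.

Lemma eval_conj_atoms (A : finType) (v : A -> bool) (X : {set A}) :
  eval v (conj_atoms X) = (X \subset [set a | v a]).
Proof.
rewrite /conj_atoms; have -> : (X \subset [set a | v a]) = all v (enum X).
  apply/subsetP/allP => vX a; first by rewrite mem_enum => /vX; rewrite inE.
  by rewrite inE => aX; apply: vX; rewrite mem_enum.
by elim: (enum X) => //= a s ->.
Qed.

Lemma eval_premise (A : finType) (Theta : stratified_kb A) (i : nat)
    (f : Defs.form A) (v : A -> bool) :
  (i <= size Theta)%N ->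
  eval v (premise Theta i f) =
    (i <= rank Theta [set a | v a])%N && eval v f.
Proof.
rewrite /premise /rank; elim: Theta i => [|g Theta IH] [|i] //= iT.
rewrite IH // -(@eval_ext _ v) => [|a]; last by rewrite /= inE.
by case: (eval v g).
Qed.

Lemma kb_entails_maximal_rank (A : finType) (Theta : stratified_kb A)
    (X : {set A}) (b : A) :
  kb_entails Theta (conj_atoms X) (FVar b) <->
  (forall W : {set A}, X \subset W ->
     (forall V : {set A}, X \subset V -> (rank Theta V <= rank Theta W)%N) ->
     b \in W).
Proof.
have setK (W : {set A}) : [set a | mem W a] = W by apply/setP => a; rewrite inE.
split=> [[i [iT pos neg]] W XW topW|top].
  have [iW|Wi] := leqP i (rank Theta W).
    apply: (pos (mem W)).
    by rewrite eval_premise // eval_conj_atoms setK iW.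
  (* For [i] above the maximal rank the premise has no model, so it would also entail the negation
     of [b]. *)
  case: neg => v; rewrite eval_premise // eval_conj_atoms => /andP[iv Xv].
  by have := leq_trans iv (topW _ Xv); rewrite leqNgt Wi.
(* The witness [i] is the largest rank of a world containing [X]: the models of the premise are then
   exactly the worlds of maximal rank. *)
case: (arg_maxnP (P := fun W : {set A} => X \subset W) (rank Theta) (subsetT X)).
move=> W XW topW; exists (rank Theta W).
have WT : (rank Theta W <= size Theta)%N by apply: find_size.
split=> // [v|neg].
  rewrite eval_premise // eval_conj_atoms => /andP[Wv Xv].
  suff : b \in [set a | v a] by rewrite inE.
  by apply: top => // V XV; apply: leq_trans (topW V XV) Wv.
have := neg (mem W); rewrite eval_premise // eval_conj_atoms setK leqnn XW /=.
by move/(_ isT); rewrite (top W XW topW).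
Qed.

Section WorldEmbedding.

Variables (R : realType) (A : finType) (Theta : stratified_kb A).

Let N : R := #|{set A}|%:R.

Definition world_emb (a : A) : 'rV[R]_#|{: {set A}}| :=
  \row_j (N ^+ rank Theta (enum_val j) *
          vote R (fun W : {set A} => a \in W) (enum_val j)).

Lemma relu_world_emb (X : {set A}) j :
  X != set0 ->
  relu (Emb_avg world_emb X) 0 j =
    if X \subset enum_val j then N ^+ rank Theta (enum_val j) else 0.
Proof.
move=> X0; have cX : (0 : R) < #|X|%:R by rewrite ltr0n card_gt0.
rewrite /relu /Emb_avg !mxE summxE.
under eq_bigr do rewrite mxE.
rewrite -mulr_sumr; set W := enum_val j.
have w0 : 0 <= N ^+ rank Theta W by rewrite exprn_ge0 ?ler0n.
case: ifPn => [XW|/subsetPn[a aX aW]].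
  rewrite (eq_bigr (fun=> 1)) => [|a aX]; last by rewrite /vote (subsetP XW).
  rewrite sumr_const mulrCA mulVf ?mulr1 ?gt_eqF //.
  exact/max_idPl.
apply/max_idPr; rewrite pmulr_rle0 ?invr_gt0 // mulr_ge0_le0 //.
rewrite (bigD1 a) //= {1}/vote (negPf aW) addrC subr_le0.
(* The members of [X] other than [a] add at most 1 each, hence at most #|A| < 2^#|A| = [N] in
   total. *)
apply: (@le_trans _ _ (\sum_(i in X | i != a) 1)).
  apply: ler_sum => i _; rewrite /vote; case: ifP => // _.
  by rewrite (le_trans _ ler01) // oppr_le0 ler0n.
rewrite sumr_const ler_nat; apply: leq_trans (max_card _) _.
by rewrite -cardsT -cardsT -powersetT card_powerset cardsT ltnW // ltn_expl.
Qed.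

(** The weight of an active world enters twice, through the average and through the vector of [b],
    hence the square. *)
Lemma score_world_emb (X : {set A}) (b : A) :
  X != set0 ->
  dotrv (relu (Emb_avg world_emb X)) (world_emb b) =
    \sum_(W : {set A} | X \subset W)
      (N ^+ rank Theta W) ^+ 2 * vote R (fun W : {set A} => b \in W) W.
Proof.
move=> X0; rewrite big_mkcond big_enum_val; apply: eq_bigr => j _.
rewrite relu_world_emb // mxE; case: ifP => _; last exact: mul0r.
by rewrite mulrA -expr2.
Qed.

End WorldEmbedding.

Theorem proposition4 (R : realType) (A : finType) (Theta : stratified_kb A) :
  exists (m : nat) (emb : A -> 'rV[R]_m),
    forall (b : A) (X : {set A}), X != set0 ->
      (b \in Lab_relu emb (Emb_avg emb X)
       <-> kb_entails Theta (conj_atoms X) (FVar b)).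
Proof.
exists #|{: {set A}}|, (world_emb R Theta) => b X X0.
rewrite inE score_world_emb //.
apply: iff_trans (iff_sym (kb_entails_maximal_rank Theta X b)).
exact: vote_sum_ge0 (subsetT X).
Qed.
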